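(* Any finite forest $\Lambda$ is isomorphic to an induced subgraph of the extension graph $P_4^e$ of the path $P_4$ on four vertices; in particular, $A(\Lambda)$ embeds into $A(P_4)$.
   Context: A graph is a (possibly infinite) simplicial 1-complex (no loops, no multi-edges). For a graph $\Gamma$ with vertex set $V(\Gamma)$ and edge set $E(\Gamma)$, the right-angled Artin group is $A(\Gamma)=\langle V(\Gamma)\mid [v,v']=1 \text{ for each } \{v,v'\}\in E(\Gamma)\rangle$. The extension graph $\Gamma^e$ is the graph whose vertices are the elements of $A(\Gamma)$ that are conjugate to vertices of $\Gamma$ (viewed as generators), two distinct vertices being adjacent if and only if they commute in $A(\Gamma)$. A forest is a disjoint union of trees. A group $H$ embeds into $G$ if there is an injective homomorphism $H\to G$. *)

(* Defs.v *)
From HB Require Import structures.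
From mathcomp Require Import all_boot.
From mathcomp Require Import boolp classical_sets cardinality.

Set Implicit Arguments.
Unset Strict Implicit.
Unset Printing Implicit Defensive.

Local Open Scope classical_set_scope.
Local Open Scope quotient_scope.
Local Open Scope group_scope.

(* Graphs, possibly infinite.  Asking for a choiceType of vertices and a
   boolean adjacency is no restriction: in the presence of the axioms of boolp
   every type has a choice structure and every relation a boolean version. *)

Record graph := Graph {
  vertex :> choiceType;
  adj : rel vertex;
  adj_sym : symmetric adj;
  adj_irr : irreflexive adj
}.

Definition graph_iso (G H : graph) : Prop :=
  exists2 f : G -> H, bijective f & {mono f : x y / adj x y}.

Section InducedSubgraph.
Variables (G : graph) (S : set G).

Definition induced_adj : rel (set_type S) := fun x y => adj (val x) (val y).

Fact induced_adj_sym : symmetric induced_adj.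
Proof. by move=> x y; apply: adj_sym. Qed.

Fact induced_adj_irr : irreflexive induced_adj.
Proof. by move=> x; apply: adj_irr. Qed.

Definition induced_subgraph : graph := Graph induced_adj_sym induced_adj_irr.

End InducedSubgraph.

Definition finite_graph (G : graph) : Prop := finite_set [set: G].

Definition connected_graph (G : graph) : Prop :=
  forall x y : G, exists2 p : seq G, path (@adj G) x p & last x p = y.

Definition acyclic_graph (G : graph) : Prop :=
  forall c : seq G, ucycle (@adj G) c -> (size c < 3)%N.

(* The empty graph is not a tree, but it is a forest: the union of no tree. *)
Definition is_tree (G : graph) : Prop :=
  [/\ [set: G] !=set0, connected_graph G & acyclic_graph G].

Section DisjointUnion.
Variables (I : choiceType) (T : I -> graph).

Definition union_adj : rel {i : I & T i} :=
  fun x y => (tag x == tag y) && adj (tagged x) (tagged_as x y).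

Fact union_adj_sym : symmetric union_adj.
Proof.
move=> [i x] [j y]; rewrite /union_adj /= [j == i]eq_sym.
by case: eqP => //= eq_ij; case: j / eq_ij y => y; rewrite !tagged_asE adj_sym.
Qed.

Fact union_adj_irr : irreflexive union_adj.
Proof. by move=> [i x]; rewrite /union_adj eqxx tagged_asE adj_irr. Qed.

Definition disjoint_union : graph := Graph union_adj_sym union_adj_irr.

End DisjointUnion.

Definition is_forest (G : graph) : Prop :=
  exists (I : choiceType) (T : I -> graph),
    (forall i, is_tree (T i)) /\ graph_iso G (disjoint_union T).

Section PathGraph.
Variable n : nat.

Definition path_adj : rel 'I_n := fun i j => (i.+1 == j) || (j.+1 == i).

Fact path_adj_sym : symmetric path_adj.
Proof. by move=> i j; rewrite /path_adj orbC. Qed.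

Fact path_adj_irr : irreflexive path_adj.
Proof. by move=> i; rewrite /path_adj orbb gtn_eqF. Qed.

Definition path_graph : graph := Graph path_adj_sym path_adj_irr.

End PathGraph.

(* The letters (x, false) and (x, true) stand for x and x^-1. *)
Definition word (X : choiceType) : choiceType := seq (X * bool).

Definition word_inv (X : choiceType) (w : word X) : word X :=
  rev [seq (l.1, ~~ l.2) | l <- w].

Section Presentation.
Variables (X : choiceType) (R : set (word X)).

Inductive pres_eq : word X -> word X -> Prop :=
| PresRefl u : pres_eq u u
| PresSym u v : pres_eq u v -> pres_eq v u
| PresTrans u v w : pres_eq u v -> pres_eq v w -> pres_eq u w
| PresCancel u v x b : pres_eq (u ++ [:: (x, b); (x, ~~ b)] ++ v) (u ++ v)
| PresRelator u v r : R r -> pres_eq (u ++ r ++ v) (u ++ v).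

Definition pres_eqb : rel (word X) := fun u v => `[< pres_eq u v >].

Fact pres_eqb_refl : reflexive pres_eqb.
Proof. by move=> u; apply/asboolP; apply: PresRefl. Qed.

Fact pres_eqb_sym : symmetric pres_eqb.
Proof. by move=> u v; apply/asboolP/asboolP; apply: PresSym. Qed.

Fact pres_eqb_trans : transitive pres_eqb.
Proof.
by move=> v u w /asboolP uv /asboolP vw; apply/asboolP; apply: PresTrans uv vw.
Qed.

Canonical pres_equiv := EquivRel pres_eqb
  pres_eqb_refl pres_eqb_sym pres_eqb_trans.

(* The group < X | R >. *)
Definition presented := {eq_quot pres_equiv}.

HB.instance Definition _ := Choice.on presented.
HB.instance Definition _ := EqQuotient.on presented.

Definition pres_class (w : word X) : presented := \pi_presented w.

Definition pres_one : presented := pres_class [::].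
Definition pres_mul := lift_op2 presented (@cat (X * bool)).
Definition pres_inv := lift_op1 presented (@word_inv X).

Fact pres_classP u v : pres_class u = pres_class v <-> pres_eq u v.
Proof.
split=> [/eqmodP /asboolP //|uv].
by apply/eqmodP/asboolP.
Qed.

Fact pres_eq_catl w u v : pres_eq u v -> pres_eq (w ++ u) (w ++ v).
Proof.
elim=> {u v} [u|u v _|u v t _ ut _|u v x b|u v r Rr].
- exact: PresRefl.
- exact: PresSym.
- exact: PresTrans.
- by rewrite !(catA w); apply: PresCancel.
- by rewrite !(catA w); apply: PresRelator.
Qed.

Fact pres_eq_catr w u v : pres_eq u v -> pres_eq (u ++ w) (v ++ w).
Proof.
elim=> {u v} [u|u v _|u v t _ ut _|u v x b|u v r Rr].
- exact: PresRefl.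
- exact: PresSym.
- exact: PresTrans.
- by rewrite -!catA; apply: PresCancel.
- by rewrite -!catA; apply: PresRelator.
Qed.

Fact pres_repr w : pres_eq (repr (pres_class w)) w.
Proof. by apply/pres_classP; rewrite /pres_class reprK. Qed.

Fact pres_mulE u v : pres_mul (pres_class u) (pres_class v) = pres_class (u ++ v).
Proof.
rewrite /pres_mul -lock; apply/pres_classP; apply: (PresTrans (v := u ++ repr (pres_class v))).
  exact/pres_eq_catr/pres_repr.
exact/pres_eq_catl/pres_repr.
Qed.

Fact pres_classK g : pres_class (repr g) = g.
Proof. exact: reprK. Qed.

Fact pres_mulA : associative pres_mul.
Proof.
move=> x y z; rewrite -(pres_classK x) -(pres_classK y) -(pres_classK z).
by rewrite !pres_mulE catA.
Qed.

Fact pres_mul1 : left_id pres_one pres_mul.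
Proof. by move=> x; rewrite -(pres_classK x) pres_mulE. Qed.

Fact pres_mulr1 : right_id pres_one pres_mul.
Proof. by move=> x; rewrite -(pres_classK x) pres_mulE cats0. Qed.

Fact word_invK : involutive (@word_inv X).
Proof.
move=> w; rewrite /word_inv map_rev revK -map_comp map_id_in // => -[x b] _ /=.
by rewrite negbK.
Qed.

Fact pres_eq_catV w : pres_eq (w ++ word_inv w) [::].
Proof.
elim: w => [|[x b] w IHw]; first exact: PresRefl.
have -> : word_inv ((x, b) :: w) = word_inv w ++ [:: (x, ~~ b)].
  by rewrite /word_inv /= rev_cons cats1.
rewrite catA cat_cons; apply: PresTrans (PresCancel [::] [::] x b).
exact/(pres_eq_catl [:: (x, b)])/(pres_eq_catr [:: (x, ~~ b)] IHw).
Qed.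

Fact pres_invE g : pres_inv g = pres_class (word_inv (repr g)).
Proof. by rewrite /pres_inv -lock. Qed.

Fact pres_mulrV : right_inverse pres_one pres_inv pres_mul.
Proof.
move=> x; rewrite pres_invE -{1}(pres_classK x) pres_mulE.
exact/pres_classP/pres_eq_catV.
Qed.

Fact pres_mulV : left_inverse pres_one pres_inv pres_mul.
Proof.
move=> x; rewrite pres_invE -{2}(pres_classK x) pres_mulE; apply/pres_classP.
by rewrite -{2}[repr x]word_invK; apply: pres_eq_catV.
Qed.

HB.instance Definition _ := isGroup.Build presented
  pres_mulA pres_mul1 pres_mulr1 pres_mulV pres_mulrV.

Definition pres_gen (x : X) : presented := pres_class [:: (x, false)].

End Presentation.

Section RightAngledArtin.
Variable G : graph.

Definition raag_relators : set (word G) :=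
  [set r | exists v w : G, adj v w /\
    r = [:: (v, true); (w, true); (v, false); (w, false)]].

Definition raag : groupType := presented raag_relators.

Definition raag_gen (v : G) : raag := pres_gen raag_relators v.

Definition ext_vertices : set raag :=
  [set g | exists (v : G) (h : raag), g = raag_gen v ^ h].

Definition ext_adj : rel (set_type ext_vertices) :=
  fun x y => (x != y) && `[< commute (val x) (val y) >].

Fact ext_adj_sym : symmetric ext_adj.
Proof.
move=> x y; rewrite /ext_adj eq_sym; congr andb.
by apply/asboolP/asboolP => /esym.
Qed.

Fact ext_adj_irr : irreflexive ext_adj.
Proof. by move=> x; rewrite /ext_adj eqxx. Qed.

Definition extension_graph : graph := Graph ext_adj_sym ext_adj_irr.

End RightAngledArtin.

Definition group_embeds (H G : groupType) : Prop :=
  exists f : {multiplicative H -> G}, injective f.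

(* Main.v *)
(* For the path a - b - c - d, let T be the incidence graph of the points of
   Z^2 and the lines y = m x - k, with m and k in Z: it is infinitely branching
   and has no 4-cycle.  Two shears of the plane, one fixing the point
   o = (0, 0), the other fixing the line o' : y = 0 through o, act on A(T);
   letting a and d act as these shears, b and c as left multiplication by o
   and o', makes A(P_4) act on A(T).  For h in <a, d>, the conjugate h b h^-1
   (or h c h^-1) then acts as left multiplication by the vertex h o (or h o')
   of T.

   A finite forest is built by adding one by one vertices with at most one
   previous neighbour; a vertex h b h^-1 receives its new neighbour among the
   h a^n c a^-n h^-1, with n large enough to avoid accidental adjacencies in T.
   This realizes L both by conjugates of b and c that commute along the edges,
   whence a homomorphism A(L) -> A(P_4), and as an induced subgraph of T, so
   that A(L) is a retract of A(T); the action on A(T) shows that the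
   homomorphism is injective.  As two generators of A(L) commute only if they
   are equal or adjacent, L is an induced subgraph of the extension graph. *)

Require Import Defs.
From HB Require Import structures.
From mathcomp Require Import all_boot perm ssralg ssrint zify.
From mathcomp Require Import boolp classical_sets cardinality.

Set Implicit Arguments.
Unset Strict Implicit.
Unset Printing Implicit Defensive.

Local Open Scope group_scope.

(** * Forests: acyclicity and orderings by leaves *)

Lemma union_adj_path (I : choiceType) (T : I -> graph) (i : I) (x : T i) p :
  path (@union_adj I T) (Tagged T x) p ->
  exists2 q, path (@adj (T i)) x q & p = [seq Tagged T y | y <- q].
Proof.
elim: p x => [|[j y] p IHp] x /=; first by exists [::].
case/andP=> /andP[/= /eqP ij]; case: j / ij y => y.
rewrite tagged_asE => xy /IHp[q yq ->].
by exists (y :: q) => //=; rewrite xy.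
Qed.

(** A path in a disjoint union stays in the component of its start, so a cycle of [G] would be
    carried into a single tree. *)
Lemma forest_acyclic (G : graph) : is_forest G -> acyclic_graph G.
Proof.
move=> [I [T [treeT [f bij_f fE]]]] [//|x c] /andP[cyc uniq_c].
have [[i y] fx] : exists y, f x = y by eexists.
have : path (@union_adj I T) (f x) (map f (rcons c x)).
  by rewrite path_map; apply: sub_path cyc => u v; rewrite /= -fE.
rewrite map_rcons fx => /union_adj_path[q].
case: (lastP q) => [|{}q z]; first by case: (map f c).
rewrite map_rcons => yq /rcons_inj[fc yz].
rewrite -(eq_from_Tagged yz) {z yz} in yq; case: (treeT i) => _ _ /(_ (y :: q)).
rewrite /= -(size_map (Tagged T) q) -fc size_map; apply.
rewrite /ucycle /cycle yq; move: uniq_c.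
rewrite -(map_inj_uniq (bij_inj bij_f)) map_cons fx fc.
rewrite -[_ :: _]/(map (Tagged T) (y :: q)) map_inj_uniq // => u v.
exact: eq_from_Tagged.
Qed.

Lemma acyclic_leaf (G : graph) (s : seq G) : acyclic_graph G -> s != [::] ->
  exists2 x, x \in s &
    {in s &, forall y z, adj x y -> adj x z -> y = z}.
Proof.
move=> acG s_neq0; apply: contrapT => noleaf.
have branch x t : x \in s -> exists z, [/\ z \in s, adj x z & z != t].
  move=> xs; apply: contrapT => nobranch; apply: noleaf; exists x => // y z.
  have alone u : u \in s -> adj x u -> u = t.
    move=> us xu; apply/eqP/negPn/negP => ut; apply: nobranch.
    by exists u.
  by move=> ys zs xy xz; apply: etrans (alone y ys xy) (esym (alone z zs xz)).
(* Any simple path extends: a neighbour of its head inside the path and other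
   than the next vertex would close a cycle. *)
have longer k : exists x p,
    [/\ size p = k, path (@adj G) x p, uniq (x :: p) & {subset x :: p <= s}].
  elim: k => [|k [x [p [sz_p xp Up sub_p]]]].
    case: s s_neq0 {noleaf branch} => // x s _; exists x, [::]; split=> // y.
    by rewrite inE => /eqP->; apply: mem_head.
  have xs : x \in s by apply: sub_p; rewrite mem_head.
  (* For empty [p] the default [x] of [head] is harmless: no vertex is adjacent to itself. *)
  have [z [zs xz zp]] := branch x (head x p) xs.
  have zx : z != x by apply: contraL xz => /eqP->; rewrite adj_irr.
  have [zinp|zninp] := boolP (z \in p); last first.
    exists z, (x :: p); split; first by rewrite /= sz_p.
    - by rewrite /= adj_sym xz.
    - by rewrite cons_uniq Up inE (negPf zx) zninp.
    by move=> y; rewrite inE => /predU1P[->|/sub_p].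
  move: zinp => /splitPr def_p.
  case: p / def_p => p1 p2 in sz_p xp Up sub_p zp *.
  have p1_gt0 : (0 < size p1)%N.
    by case: p1 zp {sz_p xp Up sub_p} => //=; rewrite eqxx.
  have : ucycle (@adj G) (x :: rcons p1 z).
    rewrite /ucycle /cycle rcons_path last_rcons [adj z x]adj_sym xz andbT.
    rewrite -cat_rcons -cat_cons in xp Up.
    move: xp Up; rewrite cat_path cat_uniq.
    by move=> /andP[-> _] /andP[-> _].
  by move=> /acG; rewrite /= size_rcons !ltnS leqNgt p1_gt0.
have [x [p [sz_p _ Up sub_p]]] := longer (size s).
by have := uniq_leq_size Up sub_p; rewrite /= sz_p ltnn.
Qed.

(** Read from the end of the list: the head is the vertex added last. *)
Fixpoint leaf_ordered (G : graph) (s : seq G) : Prop :=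
  if s is x :: s' then
    [/\ x \notin s', {in s' &, forall y z, adj x y -> adj x z -> y = z}
      & leaf_ordered s']
  else True.

Lemma acyclic_leaf_ordered (G : graph) (s : seq G) : acyclic_graph G ->
  exists2 s', s' =i s & leaf_ordered s'.
Proof.
move=> acG; have [n] := ubnP (size s); elim: n s => // n IHn s.
have [->|s_neq0] := eqVneq s [::]; first by exists [::].
have [x xs leaf_x] := acyclic_leaf acG s_neq0 => sz_s.
have [|s' s'E ord_s'] := IHn (filter (predC1 x) s).
  move: sz_s; rewrite ltnS; apply: leq_trans.
  rewrite size_filter -(count_predC (pred1 x) s).
  by rewrite -[X in (X < _)%N]add0n ltn_add2r -has_count has_pred1.
exists (x :: s') => [y|].
  by rewrite inE s'E mem_filter /=; case: eqVneq => [->|].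
split=> //; first by rewrite s'E mem_filter /= eqxx.
move=> y z; rewrite !s'E !mem_filter => /andP[_ ys] /andP[_ zs].
exact: leaf_x.
Qed.

(** Lets a single index avoid the accidental adjacencies with all vertices placed so far. *)
Lemma eventually_all (T : eqType) (P : T -> nat -> Prop) (s : seq T) :
  {in s, forall z, exists N, forall n, (N <= n)%N -> P z n} ->
  exists n, {in s, forall z, P z n}.
Proof.
move=> ev.
suff [N NP]: exists N, forall n, (N <= n)%N -> {in s, forall z, P z n}.
  by exists N; apply: NP.
elim: s ev => [|x s IHs] ev; first by exists 0%N.
have [N1 P1] := ev x (mem_head _ _).
have [z zs|N2 P2] := IHs; first by apply: ev; rewrite inE zs orbT.
exists (maxn N1 N2) => n; rewrite geq_max => /andP[le1 le2] z.
by rewrite inE => /predU1P[->|zs]; [apply: P1|apply: P2].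
Qed.

(** * Homomorphisms out of presented groups and Artin groups *)

Lemma pres_classM (X : choiceType) (R : set (word X)) (u v : word X) :
  pres_class R (u ++ v) = pres_class R u * pres_class R v.
Proof. exact/esym/pres_mulE. Qed.

Lemma pres_genV (X : choiceType) (R : set (word X)) (x : X) :
  pres_class R [:: (x, true)] = (pres_gen R x)^-1.
Proof.
apply/eqP; rewrite -mulg_eq1 -pres_classM; apply/eqP/pres_classP.
exact: (PresCancel R [::] [::] x true).
Qed.

Section PresentedLift.
Variables (X : choiceType) (R : set (word X)) (H : groupType) (phi : X -> H).

Definition eval_letter (l : X * bool) : H :=
  if l.2 then (phi l.1)^-1 else phi l.1.

Definition eval_word (w : word X) : H := \prod_(l <- w) eval_letter l.

Lemma eval_word_cat u v : eval_word (u ++ v) = eval_word u * eval_word v.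
Proof. exact: big_cat. Qed.

Lemma eval_word_pres (u v : word X) :
  (forall r, R r -> eval_word r = 1) -> pres_eq R u v ->
  eval_word u = eval_word v.
Proof.
move=> R1; elim=> {u v} [//|//|u v w _ -> _ -> //|u v x b|u v r /R1 r1].
  rewrite !eval_word_cat /eval_word !big_cons big_nil mulg1; congr (_ * _).
  by case: b; rewrite /eval_letter /= ?mulgV ?mulVg mul1g.
by rewrite !eval_word_cat r1 mul1g.
Qed.

Lemma presented_lift : (forall r, R r -> eval_word r = 1) ->
  exists f : UMagmaMorphism.type (presented R) H,
    forall x, f (pres_gen R x) = phi x.
Proof.
move=> R1; pose f (g : presented R) := eval_word (repr g).
have fE w : f (pres_class R w) = eval_word w.
  exact: eval_word_pres R1 (pres_repr R w).
have fM : {morph f : x y / x * y}.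
  move=> x y; rewrite -(pres_classK x) -(pres_classK y).
  by rewrite -pres_classM !fE eval_word_cat.
have fF : {morph f : x y / x / y}.
  by move=> x y; apply: (mulIg (f y)); rewrite -fM !mulgVK.
pose fMix := isGroupMorphism.Build _ _ f fF.
pose F : UMagmaMorphism.type (presented R) H := HB.pack f fMix.
by exists F => x; rewrite /= fE /eval_word big_seq1.
Qed.

End PresentedLift.

Lemma presented_hom_ext (X : choiceType) (R : set (word X)) (H : groupType)
    (f g : UMagmaMorphism.type (presented R) H) :
  (forall x, f (pres_gen R x) = g (pres_gen R x)) -> f =1 g.
Proof.
move=> fg z; rewrite -(pres_classK z).
elim: (repr z) => [|[x b] w IHw].
  by rewrite -[pres_class R _]/(1 : presented R) !gmulf1.
rewrite -cat1s pres_classM !gmulfM {}IHw; congr (_ * _).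
case: b; last exact: fg.
by rewrite pres_genV !gmulfV fg.
Qed.

Lemma raag_lift (G : graph) (H : groupType) (phi : G -> H) :
  (forall v w, adj v w -> commute (phi v) (phi w)) ->
  exists f : UMagmaMorphism.type (raag G) H, forall v, f (raag_gen v) = phi v.
Proof.
move=> phiC; apply: presented_lift => _ [v [w [vw ->]]].
rewrite /eval_word !big_cons big_nil /eval_letter /= mulg1.
by rewrite (phiC _ _ vw) mulgA -invgM mulVg.
Qed.

Lemma raag_gen_commute (G : graph) (v w : G) :
  adj v w -> commute (raag_gen v) (raag_gen w).
Proof.
move=> vw.
have : pres_class (@raag_relators G)
    [:: (v, true); (w, true); (v, false); (w, false)] = 1.
  apply/pres_classP.
  have := @PresRelator _ (@raag_relators G) [::] [::]
    [:: (v, true); (w, true); (v, false); (w, false)].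
  by apply; exists v, w.
move=> E.
apply/esym; apply: (mulgI (raag_gen w * raag_gen v)^-1).
by rewrite mulVg invgM -E -!pres_genV -mulgA -!pres_classM.
Qed.

(** Sending [v] to a transposition and every other generator to 1 separates [v] from [w]. *)
Lemma raag_gen_inj (G : graph) : injective (@raag_gen G).
Proof.
move=> v w vw; apply/eqP/negPn/negP => nvw.
pose phi u : {perm 'I_2} := if u == v then tperm ord0 ord_max else 1.
have [|f fE] := @raag_lift G _ phi.
  move=> x y; rewrite /phi; case: eqP => [->|_ _]; last exact/esym/commute1.
  by case: eqP => [->|_ _]; [rewrite adj_irr|exact: commute1].
have := congr1 f vw; rewrite !fE /phi eqxx eq_sym (negPf nvw).
by move/permP/(_ ord0); rewrite tpermL perm1.
Qed.

(** If [v] and [w] were not adjacent, sending them to two non-commuting transpositions of three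
    points, and the other generators to 1, would respect all relations. *)
Lemma raag_gen_commuteP (G : graph) (v w : G) :
  v != w -> commute (raag_gen v) (raag_gen w) -> adj v w.
Proof.
move=> nvw cvw; apply/negPn/negP => navw.
pose a : {perm 'I_3} := tperm ord0 (inord 1).
pose b : {perm 'I_3} := tperm ord0 (inord 2).
pose phi u := if u == v then a else if u == w then b else 1.
have [|f fE] := @raag_lift G _ phi.
  move=> x y; rewrite /phi; case: eqP => [->|_].
    case: eqP => [->|_]; first by rewrite adj_irr.
    by case: eqP => [->|_ _]; [rewrite (negPf navw)|exact: commute1].
  case: eqP => [->|_ _]; last exact/esym/commute1.
  case: eqP => [->|_]; first by rewrite adj_sym (negPf navw).
  by case: eqP => [->|_ _]; [rewrite adj_irr|exact: commute1].
have := gmulf_commute f cvw.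
rewrite !fE /phi eqxx eq_sym (negPf nvw) eqxx => /permP /(_ ord0).
rewrite !permM !tpermL !tpermD -?val_eqE /= ?inordK //.
by move/(congr1 val); rewrite /= !inordK.
Qed.

(** * The group of symmetries of a possibly infinite set *)

(** Carrying the inverse as data makes inversion a mere swap; [symmetry_ext] shows that it adds no
    information. *)
Record symmetry (X : Type) := Symmetry {
  fwd :> X -> X;
  bwd : X -> X;
  fwdK : cancel fwd bwd;
  bwdK : cancel bwd fwd
}.

Section SymmetryGroup.
Variable X : Type.
Implicit Types f g h : symmetry X.

HB.instance Definition _ := gen_eqMixin (symmetry X).
HB.instance Definition _ := gen_choiceMixin (symmetry X).

Lemma symmetry_ext f g : fwd f =1 fwd g -> f = g.
Proof.
case: f g => [f f' fK f'K] [g g' gK g'K] /= /funext fg; subst g.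
have e : f' = g' by apply/funext => x; rewrite -{1}(g'K x) fK.
by subst g'; congr Symmetry; apply: Prop_irrelevance.
Qed.

Definition symmetry_one := @Symmetry X id id (fun=> erefl) (fun=> erefl).
Definition symmetry_inv f := Symmetry (@bwdK X f) (@fwdK X f).
Definition symmetry_mul f g :=
  Symmetry (can_comp (@fwdK X f) (@fwdK X g))
           (can_comp (@bwdK X g) (@bwdK X f)).

Fact symmetry_mulA : associative symmetry_mul.
Proof. by move=> f g h; apply: symmetry_ext. Qed.
Fact symmetry_mul1 : left_id symmetry_one symmetry_mul.
Proof. by move=> f; apply: symmetry_ext. Qed.
Fact symmetry_mulr1 : right_id symmetry_one symmetry_mul.
Proof. by move=> f; apply: symmetry_ext. Qed.
Fact symmetry_mulV : left_inverse symmetry_one symmetry_inv symmetry_mul.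
Proof. by move=> f; apply: symmetry_ext => x; apply: fwdK. Qed.
Fact symmetry_mulrV : right_inverse symmetry_one symmetry_inv symmetry_mul.
Proof. by move=> f; apply: symmetry_ext => x; apply: bwdK. Qed.

HB.instance Definition _ := isGroup.Build (symmetry X)
  symmetry_mulA symmetry_mul1 symmetry_mulr1 symmetry_mulV symmetry_mulrV.

End SymmetryGroup.

Section LeftTranslation.
Variable H : groupType.

Definition translation (g : H) : symmetry H :=
  Symmetry (@mulKg H g) (@mulVKg H g).

Fact translationF : {morph translation : g h / g / h}.
Proof. by move=> g h; apply: symmetry_ext => x; rewrite /= mulgA. Qed.

HB.instance Definition _ := isGroupMorphism.Build _ _ translation translationF.

End LeftTranslation.

(** * The point-line incidence graph and the action of A(P_4) *)

(* (true, (p, q)) is the point (p, q) and (false, (m, k)) the line y = m x - k;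
   incidence reads q + k = m p, which is symmetric under point-line duality. *)
Definition flag_adj : rel (bool * (int * int)) := fun u v =>
  (u.1 != v.1) && (u.2.2 + v.2.2 == u.2.1 * v.2.1)%R.

Fact flag_adj_sym : symmetric flag_adj.
Proof.
by move=> u v; rewrite /flag_adj eq_sym GRing.addrC GRing.mulrC.
Qed.

Fact flag_adj_irr : irreflexive flag_adj.
Proof. by move=> u; rewrite /flag_adj eqxx. Qed.

Definition plane : graph := Graph flag_adj_sym flag_adj_irr.

Definition origin (s : bool) : plane := (s, (0, 0))%R.

(* For s = true this is the map (p, q) |-> (p, q + n p) on points, for s = false
   the translation (p, q) |-> (p + n, q). *)
Definition shear (s : bool) (n : int) (u : plane) : plane :=
  if u.1 == s then (u.1, (u.2.1, u.2.2 + n * u.2.1))%R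
  else (u.1, (u.2.1 + n, u.2.2))%R.

Lemma shearD s m n : shear s m \o shear s n =1 shear s (m + n)%R.
Proof.
by case: s => -[[] [x y]]; rewrite /shear /=; congr (_, (_, _)); lia.
Qed.

Lemma shear0 s : shear s 0%R =1 id.
Proof.
by case: s => -[[] [x y]]; rewrite /shear /=; congr (_, (_, _)); lia.
Qed.

Lemma shearK s n : cancel (shear s n) (shear s (- n)%R).
Proof. by move=> u; rewrite [LHS]shearD GRing.addNr shear0. Qed.

(** For s = true, n p is added to both sides of q + k = m p; for s = false, n m is. *)
Lemma shear_adj s n : {mono shear s n : u v / flag_adj u v}.
Proof.
move=> [s1 [x1 y1]] [s2 [x2 y2]]; rewrite /flag_adj /shear /=.
by case: s s1 s2 => [] [] [] //=; apply/eqP/eqP; lia.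
Qed.

Lemma shear_origin s n : shear s n (origin s) = origin s.
Proof. by rewrite /shear /= eqxx GRing.mulr0. Qed.

Lemma shear_raag s n : exists S : symmetry (raag plane),
  forall u x, S (raag_gen u * x) = raag_gen (shear s n u) * S x.
Proof.
have lift m : exists f : UMagmaMorphism.type (raag plane) (raag plane),
    forall u, f (raag_gen u) = raag_gen (shear s m u).
  apply: raag_lift => u v uv; apply: raag_gen_commute.
  by rewrite /= shear_adj.
have [f fE] := lift n; have [g gE] := lift (- n)%R.
have fK : cancel f g.
  apply: (@presented_hom_ext _ _ _ (g \o f) idfun) => u /=.
  by rewrite [f _]fE [g _]gE shearK.
have gK : cancel g f.
  apply: (@presented_hom_ext _ _ _ (f \o g) idfun) => u /=.
  by rewrite [g _]gE [f _]fE -{1}[n]GRing.opprK shearK.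
by exists (Symmetry fK gK) => u x; rewrite /= gmulfM fE.
Qed.

Definition outer (s : bool) : path_graph 4 := if s then ord0 else ord_max.
Definition inner (s : bool) : path_graph 4 := if s then inord 1 else inord 2.

Lemma inner_adj s : adj (inner s) (inner (~~ s)).
Proof. by case: s; rewrite /= /path_adj /inner !inordK. Qed.

Lemma outer_inner_adj s : adj (outer s) (inner s).
Proof. by case: s; rewrite /= /path_adj /inner !inordK. Qed.

Lemma plane_action :
  exists psi :
    UMagmaMorphism.type (raag (path_graph 4)) (symmetry (raag plane)),
  (forall s, psi (raag_gen (inner s)) = translation (raag_gen (origin s))) /\
  (forall s u x, psi (raag_gen (outer s)) (raag_gen u * x)
     = raag_gen (shear s 1%R u) * psi (raag_gen (outer s)) x).
Proof.
have [S SE] := choice (fun s => shear_raag s 1%R).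
have [|psi psiE] := @raag_lift (path_graph 4) (symmetry (raag plane))
  (fun v => match val v with
            | 0 => S true
            | 1 => translation (raag_gen (origin true))
            | 2 => translation (raag_gen (origin false))
            | _ => S false end).
  (* The two outer edges of the path: a shear commutes with translation by the vertex that it
     fixes. *)
  have SC s : commute (S s) (translation (raag_gen (origin s))).
    by apply: symmetry_ext => x; rewrite /= SE shear_origin.
  have TC : commute (translation (raag_gen (origin true)))
                    (translation (raag_gen (origin false))).
    by apply/gmulf_commute/raag_gen_commute.
  case=> [[|[|[|[|//]]]] ?] [[|[|[|[|//]]]] ?] //= _; apply/commute_sym => //;
  by apply/commute_sym.
exists psi; split=> [s|s u x]; rewrite !psiE.
  by case: s; rewrite /inner /= inordK.
by case: s; rewrite /= SE.
Qed.

(** * Conjugates of b and c acting as vertices of the plane *)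

Section Realization.
Variable psi :
  UMagmaMorphism.type (raag (path_graph 4)) (symmetry (raag plane)).
Hypothesis psi_inner : forall s,
  psi (raag_gen (inner s)) = translation (raag_gen (origin s)).
Hypothesis psi_outer : forall s u x,
  psi (raag_gen (outer s)) (raag_gen u * x)
    = raag_gen (shear s 1%R u) * psi (raag_gen (outer s)) x.

(** Equivalently for the last clause, conjugation by [psi h] takes translation by the generator [u]
    to translation by [sigma u]. *)
Definition realizes (h : raag (path_graph 4)) (sigma : plane -> plane) :=
  [/\ bijective sigma, {mono sigma : u v / adj u v} &
      forall u x, psi h (raag_gen u * x) = raag_gen (sigma u) * psi h x].

Lemma realizes1 : realizes 1 id.
Proof. by split=> // [|u x]; [exists id|rewrite gmulf1]. Qed.

Lemma realizesM h k sigma tau : realizes h sigma -> realizes k tau ->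
  realizes (h * k) (sigma \o tau).
Proof.
move=> [sb sm sE] [tb tm tE]; split; first exact: bij_comp.
  by move=> u v; apply: etrans (sm _ _) (tm _ _).
by move=> u x; rewrite gmulfM /= tE sE.
Qed.

Lemma realizes_outer s n :
  realizes (raag_gen (outer s) ^+ n) (shear s n).
Proof.
elim: n => [|n IHn].
  have -> : shear s 0%N = id by apply/funext/shear0.
  exact: realizes1.
have -> : shear s n.+1 = shear s 1%R \o shear s n.
  by apply/funext => u; rewrite shearD.
rewrite expgS; apply: realizesM IHn; split; last exact: psi_outer.
  exists (shear s (- 1)%R) => u; first exact: shearK.
  by rewrite -{1}[1%R]GRing.opprK shearK.
exact: shear_adj.
Qed.

Definition lifts (u : plane) (g : raag (path_graph 4)) := exists s h sigma,
  [/\ realizes h sigma, u = sigma (origin s) & g = raag_gen (inner s) ^ h^-1].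

Lemma lifts_translation u g : lifts u g -> psi g = translation (raag_gen u).
Proof.
move=> [s [h [sigma [[_ _ sE] -> ->]]]]; apply: symmetry_ext => x.
rewrite conjgE invgK !gmulfM gmulfV psi_inner /= sE; congr (_ * _).
exact: (bwdK (psi h)).
Qed.

Lemma lifts_ext u g : lifts u g -> ext_vertices g.
Proof. by move=> [s [h [_ [_ _ ->]]]]; exists (inner s), h^-1. Qed.

Definition misses (z u : plane) := (z != u) && ~~ adj z u.

(** The candidates are the images under [sigma] of the sheared copies of the other origin; as the
    shear fixes [origin s], all of them are neighbours of [u]. *)
Lemma lifts_neighbor u g : lifts u g ->
  exists (u' : nat -> plane) (g' : nat -> raag (path_graph 4)), forall n,
    [/\ lifts (u' n) (g' n), adj u (u' n), commute g (g' n) &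
        forall z, z != u -> exists N, forall n, (N <= n)%N -> misses z (u' n)].
Proof.
move=> [s [h [sigma [hs -> ->]]]].
have hsn n := realizesM hs (realizes_outer s n).
exists (fun n => sigma (shear s n (origin (~~ s)))).
exists (fun n => raag_gen (inner (~~ s)) ^ (h * raag_gen (outer s) ^+ n)^-1).
move=> n; have [[tau sK tK] sm _] := hs; split.
- by exists (~~ s), (h * raag_gen (outer s) ^+ n), (sigma \o shear s n).
- have := shear_adj s n (origin s) (origin (~~ s)); rewrite shear_origin sm.
  by move=> E; apply: (etrans E); case: (s).
(* Since [outer s] commutes with [inner s], both elements are conjugates by the same element. *)
- have -> : raag_gen (inner s) ^ h^-1
      = raag_gen (inner s) ^ (h * raag_gen (outer s) ^+ n)^-1.
    rewrite invgM conjgM; congr (_ ^ _); apply/esym/conjg_fixP/commgP.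
    apply/commuteV/commuteX/commute_sym/raag_gen_commute.
    exact: outer_inner_adj.
  rewrite /commute -!conjMg; congr (_ ^ _).
  exact/raag_gen_commute/inner_adj.
move=> z; rewrite -[z]tK (can_eq sK); case: (tau z) => s' [x y] zs.
(* After pulling back by [sigma], equality with the candidate would force x = m, and adjacency to it
   y = x m with (x, y) nonzero; m > |x| and m > |y| exclude both. *)
exists (`|x|.+1 + `|y|.+1)%N => m lem.
rewrite /misses (can_eq sK) sm; move: zs.
rewrite /origin /shear /= /flag_adj /=.
have xmy : (x != 0 \/ y != 0 -> y <> x * m%:Z)%R.
  by have [->|x0] := eqVneq x 0%R; nia.
case: s s' {hs hsn} => [] [] /=.
all: by rewrite !xpair_eqE /= ?GRing.add0r ?GRing.addr0; lia.
Qed.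

(* The witnesses are the points (1, n), at most one of which is on a given
   line; the simpler (n, 0) would all be on the line y = 0. *)
Lemma lifts_far :
  exists (u' : nat -> plane) (g' : nat -> raag (path_graph 4)), forall n,
    lifts (u' n) (g' n) /\
    forall z, exists N, forall n, (N <= n)%N -> misses z (u' n).
Proof.
pose h (n : nat) := raag_gen (outer true) ^+ n * raag_gen (outer false) ^+ 1.
pose sg (n : nat) := shear true n \o shear false 1%N.
exists (fun n => sg n (origin true)).
exists (fun n => raag_gen (inner true) ^ (h n)^-1).
move=> n; split.
  exists true, (h n), (sg n); split=> //.
  exact: realizesM (realizes_outer _ _) (realizes_outer _ _).
move=> [s [x y]]; exists (`|x|.+1 + `|y|.+1)%N => m lem.
rewrite /misses /sg /origin /shear /= /flag_adj /=.
by case: s => /=; rewrite ?xpair_eqE /=; lia.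
Qed.

End Realization.

(** * Placing the vertices of a forest one by one *)

Lemma leaf_ordered_lifts
    (psi : UMagmaMorphism.type (raag (path_graph 4)) (symmetry (raag plane)))
    (psi_outer : forall s u x, psi (raag_gen (outer s)) (raag_gen u * x)
       = raag_gen (shear s 1%R u) * psi (raag_gen (outer s)) x)
    (L : graph) (s : seq L) :
  leaf_ordered s ->
  exists (t : L -> plane) (c : L -> raag (path_graph 4)),
    [/\ {in s, forall v, lifts psi (t v) (c v)},
        {in s &, injective t},
        {in s &, {mono t : v w / adj v w}} &
        {in s &, forall v w, adj v w -> commute (c v) (c w)}].
Proof.
elim: s => [_|x s IHs [xs leaf_x /IHs[t [c [tl ti tm cc]]]]].
  by exists (fun=> origin true), (fun=> 1).
have neq v : v \in s -> (v == x) = false.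
  by move=> vs; apply: contraNF xs => /eqP<-.
suff [u [g [ug ux gx]]] : exists u g, [/\ lifts psi u g,
    {in s, forall v, t v != u /\ adj (t v) u = adj v x} &
    {in s, forall v, adj v x -> commute (c v) g}].
  exists (fun v => if v == x then u else t v).
  exists (fun v => if v == x then g else c v).
  have ind (P : L -> L -> Prop) : P x x -> {in s, forall v, P v x /\ P x v} ->
      {in s &, forall v w, P v w} -> {in x :: s &, forall v w, P v w}.
    move=> Pxx Px Ps v w; rewrite !inE.
    move=> /predU1P[->|vs] /predU1P[->|ws] //; [|..|exact: Ps].
      by case: (Px _ ws).
    by case: (Px _ vs).
  split.
  - move=> v; rewrite inE => /predU1P[->|vs]; first by rewrite eqxx.
    by rewrite neq //; apply: tl.
  - apply: ind => // [v vs|v w vs ws]; last by rewrite !neq //; apply: ti.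
    rewrite eqxx neq //; have [/eqP tu _] := ux v vs.
    by split=> // /esym.
  - apply: ind => [|v vs|v w vs ws].
    + by rewrite eqxx !adj_irr.
    + rewrite eqxx neq // ![adj _ v]adj_sym ![adj _ (t v)]adj_sym.
      by case: (ux v vs).
    by rewrite !neq //; apply: tm.
  - apply: ind => [|v vs|v w vs ws]; first by rewrite adj_irr.
      rewrite eqxx neq // [adj x v]adj_sym; split=> /gx; first exact.
      by move=> /(_ vs)/commute_sym.
    by rewrite !neq //; apply: cc.
(* The new vertex goes next to the image of its only earlier neighbour, or else away from all
   earlier images. *)
have [[y ys xy]|noadj] := pselect (exists2 y, y \in s & adj x y).
  have [u' [g' ugE]] := lifts_neighbor psi_outer (tl y ys).
  have [v vs|n nP] := @eventually_all _
    (fun v n => v != y -> misses (t v) (u' n)) s.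
    have [->|vy] := eqVneq v y; first by exists 0%N.
    (* The last clause of [ugE] does not depend on its outer index, so any value serves. *)
    have [_ _ _ /(_ (t v))[|N NP]] := ugE 0%N.
      by apply: contra_neq vy; apply: ti.
    by exists N => n /NP.
  have [un yn cn _] := ugE n.
  exists (u' n), (g' n); split=> // v vs.
    have [->|vy] := eqVneq v y.
      rewrite yn adj_sym xy; split=> //.
      by apply: contraTneq yn => ->; rewrite adj_irr.
    have /andP[-> /negPf->] := nP v vs vy; split=> //.
    apply/esym/negP => vx; case/eqP: vy; apply: leaf_x => //.
    by rewrite adj_sym.
  by move=> vx; rewrite (leaf_x v y) // adj_sym.
have [u' [g' ugE]] := lifts_far psi_outer.
have [v vs|n nP] := @eventually_all _ (fun v n => misses (t v) (u' n)) s.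
  by have [_] := ugE 0%N; apply.
have nadj v : v \in s -> adj v x = false.
  by move=> vs; apply/negP => vx; apply: noadj; exists v; rewrite // adj_sym.
exists (u' n), (g' n); split=> [|v vs|v vs]; first by case: (ugE n).
  by have /andP[-> /negPf->] := nP v vs; rewrite nadj.
by rewrite nadj.
Qed.

(** * Injectivity and the induced subgraph *)

(** A left inverse [rho] kills the generators outside the image of [t]; it respects the relations
    because [t] reflects adjacency. *)
Lemma raag_inj (L G : graph) (t : L -> G) : injective t ->
  {mono t : v w / adj v w} ->
  exists2 iota : UMagmaMorphism.type (raag L) (raag G),
    injective iota & forall v, iota (raag_gen v) = raag_gen (t v).
Proof.
move=> t_inj t_mono.
have [|iota iotaE] := @raag_lift L (raag G) (fun v => raag_gen (t v)).
  by move=> v w vw; apply: raag_gen_commute; rewrite t_mono.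
have rEx u : exists ru : raag L, (forall v, u = t v -> ru = raag_gen v) /\
    ((forall v, u <> t v) -> ru = 1).
  have [[v ->]|nv] := pselect (exists v, u = t v).
    by exists (raag_gen v); split=> [w /t_inj->//|/(_ v)].
  by exists 1; split=> // v uv; case: nv; exists v.
have [r rE] := choice rEx.
have rt v : r (t v) = raag_gen v by case: (rE (t v)) => /(_ v)->.
have [|rho rhoE] := @raag_lift G (raag L) r.
  move=> u1 u2 u12.
  have [[v1 e1]|n1] := pselect (exists v, u1 = t v); last first.
    rewrite (proj2 (rE u1)); first exact/commute_sym/commute1.
    by move=> v e; apply: n1; exists v.
  have [[v2 e2]|n2] := pselect (exists v, u2 = t v); last first.
    rewrite (proj2 (rE u2)); first exact/commute1.
    by move=> v e; apply: n2; exists v.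
  rewrite e1 e2 !rt; apply: raag_gen_commute.
  by rewrite -t_mono -e1 -e2.
exists iota => //; apply: (can_inj (g := rho)).
apply: (@presented_hom_ext _ _ _ (rho \o iota) idfun) => v /=.
by rewrite [iota _]iotaE [rho _]rhoE rt.
Qed.

(** Injectivity of [f] pulls commutation in the target back to [raag L], where distinct generators
    commute only along edges. *)
Lemma raag_embedding_graph_iso (L G : graph)
    (f : UMagmaMorphism.type (raag L) (raag G)) : injective f ->
  (forall v, ext_vertices (f (raag_gen v))) ->
  exists S : set (extension_graph G), graph_iso L (induced_subgraph S).
Proof.
move=> f_inj f_ext.
pose e (v : L) : extension_graph G :=
  exist _ (f (raag_gen v)) (mem_set (f_ext v)).
have e_inj : injective e.
  by move=> v w /(congr1 val) /= /f_inj/raag_gen_inj.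
pose S := [set x | exists v, e v = x]%classic.
have eS v : e v \in S by apply/mem_set; exists v.
pose F v : induced_subgraph S := exist _ (e v) (eS v).
have F_inj : injective F by move=> v w /(congr1 val)/e_inj.
exists S; exists F => [|v w].
  have F_surj y : exists v, F v = y.
    by case: y => y yS; have [v ev] := set_mem yS; exists v; apply: val_inj.
  have [g gK] := choice F_surj.
  by exists g => // v; apply: F_inj; rewrite gK.
rewrite /= /induced_adj /= /ext_adj (inj_eq e_inj) /=.
apply/andP/idP => [[vw /asboolP]|vw].
  by rewrite /commute -!gmulfM => /f_inj; apply: raag_gen_commuteP.
split; first by apply: contraTneq vw => ->; rewrite adj_irr.
exact/asboolP/gmulf_commute/raag_gen_commute.
Qed.

Theorem theorem7 (L : graph) (finL : finite_graph L) (forestL : is_forest L) :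
  (exists S : set (extension_graph (path_graph 4)),
     graph_iso L (induced_subgraph S)) /\
  group_embeds (raag L) (raag (path_graph 4)).
Proof.
have [psi [psi_inner psi_outer]] := plane_action.
have [s0 s0E] := (finite_seqP _).1 finL.
have [s sE ord_s] := acyclic_leaf_ordered s0 (forest_acyclic forestL).
have vs v : v \in s.
  rewrite sE; have : [set: L]%classic v by [].
  by rewrite s0E.
have [t [c [tl ti tm cc]]] := leaf_ordered_lifts psi_outer ord_s.
have [iota iota_inj iotaE] := @raag_inj L plane t
  (fun v w => ti v w (vs v) (vs w)) (fun v w => tm v w (vs v) (vs w)).
have [f fE] := @raag_lift L _ c (fun v w => cc v w (vs v) (vs w)).
have f_inj : injective f.
  have psif : psi \o f =1 @translation (raag plane) \o iota.
    apply: presented_hom_ext => v /=.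
    rewrite [f _]fE [iota _]iotaE.
    by rewrite (lifts_translation psi_inner (tl v (vs v))).
  move=> x y fxy; apply: iota_inj; rewrite -[LHS]mulg1 -[RHS]mulg1.
  have /= := psif x; have /= := psif y; rewrite fxy => ->.
  (* A translation is determined by its value at 1. *)
  by move/(congr1 (fun g => fwd g 1)).
split; last by exists f.
apply: (raag_embedding_graph_iso f_inj) => v; rewrite fE.
exact: lifts_ext (tl v (vs v)).
Qed.
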